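(* Let $X=(X_1,\dots,X_n):\Omega\to\mathbb{R}^n$ be an uncertain variable, $f:[\![X]\!]\to\mathbb{R}^q$ a query, and $\mathfrak{M}_1,\mathfrak{M}_2:\mathbb{R}^q\to\mathbb{R}^q$ mappings such that $\mathfrak{M}_1\circ f$ is $\epsilon_1$-noiselessly private and $\mathfrak{M}_2\circ f$ is $\epsilon_2$-noiselessly private, with $\epsilon_1,\epsilon_2>0$. Then $(\mathfrak{M}_1,\mathfrak{M}_2)\circ f$, i.e. the mechanism $x\mapsto(\mathfrak{M}_1(f(x)),\mathfrak{M}_2(f(x)))$, is $(\epsilon_1+\epsilon_2)$-noiselessly private.
   Context: An uncertain variable is a map on a nonempty set $\Omega$ (no measure assumed); $[\![X]\!]=\{X(\omega):\omega\in\Omega\}$ is its range. $x_{-i}$, $X_{-i}$ denote vectors with the $i$-th entry removed. A mechanism $m$ defined on $[\![X]\!]$ is $\epsilon$-noiselessly private, $\epsilon>0$, if, with $Y=m\circ X$, the set $[\![Y|X_{-i}(\omega)=x_{-i}]\!]=\{Y(\omega):\omega\in\Omega,\ X_{-i}(\omega)=x_{-i}\}$ has at most $2^\epsilon$ elements for all $i\in\{1,\dots,n\}$ and all $x_{-i}\in[\![X_{-i}]\!]$. *)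

(* Defs.v *)
From mathcomp Require Import all_boot all_order all_algebra.
From mathcomp Require Import all_classical all_reals all_analysis.

Set Implicit Arguments.
Unset Strict Implicit.
Unset Printing Implicit Defensive.

Import Order.TTheory GRing.Theory Num.Theory.

Local Open Scope classical_set_scope.
Local Open Scope card_scope.
Local Open Scope ring_scope.

(* An uncertain variable is a plain function [X : Omega -> S]; its range is the
   library's [range X]. A map with domain that range is a function on the
   subtype [range X] (through the coercion [set_type]), so composing it with
   [X] goes through the corestriction of [X] to its range. *)
Definition to_range (Omega S : Type) (X : Omega -> S) (w : Omega) : range X :=
  SigSub (mem_set (imageT X w)).

Definition cond_range (Omega T U : Type) (Y : Omega -> T) (Z : Omega -> U)
    (z : U) : set T :=
  [set Y w | w in [set w | Z w = z]].

Definition drop_coord (R : realType) (Omega : Type) (n : nat)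
    (X : Omega -> 'rV[R]_n) (i : 'I_n) : Omega -> 'rV[R]_n.-1 :=
  fun w => col' i (X w).

(* The bound includes finiteness of [A]. *)
Definition card_at_most (R : realType) (T : Type) (A : set T) (c : R) : Prop :=
  exists2 k : nat, A #= `I_k & k%:R <= c.

Definition noiselessly_private (R : realType) (Omega : Type) (n : nat)
    (X : Omega -> 'rV[R]_n) (T : Type) (m : range X -> T) (eps : R) : Prop :=
  forall (i : 'I_n) (x' : 'rV[R]_n.-1), range (drop_coord X i) x' ->
    card_at_most (cond_range (m \o to_range X) (drop_coord X i) x')
      (2 `^ eps).

Arguments noiselessly_private {R Omega n} X {T} m eps.

(* Main.v *)
(* Given x_{-i}, the pair of outputs lies in the product of the two conditional
   ranges, so its range has at most 2^eps1 * 2^eps2 elements. *)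
Require Import Defs.
From mathcomp Require Import all_boot all_order all_algebra.
From mathcomp Require Import all_classical all_reals all_analysis.

Import Order.TTheory GRing.Theory Num.Theory.

Local Open Scope classical_set_scope.
Local Open Scope card_scope.
Local Open Scope ring_scope.

Lemma card_le_II_setX {T U : Type} {A : set T} {B : set U} {k l : nat} :
  A #<= `I_k -> B #<= `I_l -> A `*` B #<= `I_(k * l).
Proof.
move=> /pcard_leP[f] /pcard_leP[g]; apply/pcard_leP/injfunPex.
(* Two-digit encoding in base [l]: since [g b < l], the quotient by [l] recovers [f a] and the
   remainder recovers [g b]. *)
exists (fun p => (f p.1 * l + g p.2)%N) => [[a b] [/= Aa Bb]|].
  have fa : (f a < k)%N := @funS _ _ _ _ f _ Aa.
  have gb : (g b < l)%N := @funS _ _ _ _ g _ Bb.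
  by rewrite (@leq_trans ((f a).+1 * l)) ?leq_mul2r ?fa ?orbT// mulSn addnC ltn_add2r.
move=> [a b] [a' b'] /set_mem[/= Aa Bb] /set_mem[/= Aa' Bb'] eqfg.
have gb : (g b < l)%N := @funS _ _ _ _ g _ Bb.
have gb' : (g b' < l)%N := @funS _ _ _ _ g _ Bb'.
(* Division by [l] is legitimate because a point of [B] is at hand. *)
have l0 : (0 < l)%N by exact: leq_ltn_trans gb.
congr pair.
  apply: (@inj _ _ A f); rewrite ?inE//.
  by have := congr1 (divn^~ l) eqfg; rewrite !divnMDl// !divn_small// !addn0.
apply: (@inj _ _ B g); rewrite ?inE//.
by have := congr1 (modn^~ l) eqfg; rewrite !modnMDl !modn_small.
Qed.

(** Trades the exact cardinality for an injection into an initial segment, which is easier to build: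
    such an [A] is finite, and its true size is at most [k]. *)
Lemma card_at_most_leP (R : realType) (T : Type) (A : set T) (c : R) :
  card_at_most A c <-> exists2 k : nat, A #<= `I_k & k%:R <= c.
Proof.
split=> -[k Ak kc]; first by exists k => //; rewrite (card_le_eql Ak) card_lexx.
have /finite_setP[j Aj] : finite_set A by apply/finite_set_leP; exists k.
exists j => //; apply: le_trans kc.
by rewrite ler_nat -card_le_II -(card_le_eql Aj).
Qed.

Lemma card_at_most_subset_setX (R : realType) (T U : Type)
    (A : set T) (B : set U) (C : set (T * U)) (a b : R) :
  C `<=` A `*` B -> card_at_most A a -> card_at_most B b ->
  card_at_most C (a * b).
Proof.
move=> CAB /card_at_most_leP[k Ak ka] /card_at_most_leP[l Bl lb].
apply/card_at_most_leP; exists (k * l)%N; last by rewrite natrM ler_pM.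
exact: card_le_trans (subset_card_le CAB) (card_le_II_setX Ak Bl).
Qed.

Theorem theorem6 (R : realType) (Omega : Type) (Omega_neq0 : [set: Omega] !=set0)
    (n q : nat) (X : Omega -> 'rV[R]_n) (f : range X -> 'rV[R]_q)
    (M1 M2 : 'rV[R]_q -> 'rV[R]_q) (eps1 eps2 : R)
    (eps1_gt0 : 0 < eps1) (eps2_gt0 : 0 < eps2)
    (M1_private : noiselessly_private X (M1 \o f) eps1)
    (M2_private : noiselessly_private X (M2 \o f) eps2) :
  noiselessly_private X (fun x : range X => (M1 (f x), M2 (f x))) (eps1 + eps2).
Proof.
move=> i x' Xx'; rewrite powRD ?pnatr_eq0 ?implybT//.
apply: card_at_most_subset_setX (M1_private i x' Xx') (M2_private i x' Xx').
(* The same outcome [w] witnesses both components. *)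
by move=> _ [w Xw <-]; split; exists w.
Qed.
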